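(* Let $n\ge 1$ be an integer and let $a,b,c\in\mathbb{R}$ with $ac>0$. Put $s=\sqrt{ac}$, $A_n=A_n(a,b,c)$ and $x=b/(2s)$. Then $$\det(A_n)=s^{n}\,U_n(x).$$ Equivalently, the characteristic polynomial $\chi_n(t)=\det(tI_n-A_n)$ of $A_n$ is given by $$\chi_n(t)=s^{n}\,U_n\left(\frac{t-b}{2s}\right).$$
   Context: For $n\ge 1$ and $a,b,c\in\mathbb{R}$, $A_n(a,b,c)$ denotes the $n\times n$ tridiagonal Toeplitz matrix with all diagonal entries equal to $b$, all subdiagonal entries (positions $(i+1,i)$) equal to $a$, all superdiagonal entries (positions $(i,i+1)$) equal to $c$, and all other entries $0$. $U_m$ denotes the Chebyshev polynomial of the second kind: $U_0(x)=1$, $U_1(x)=2x$, $U_{m+1}(x)=2x\,U_m(x)-U_{m-1}(x)$. *)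

(* Defs.v *)
From HB Require Import structures.
From mathcomp Require Import all_boot all_order all_algebra.
Set Implicit Arguments.
Unset Strict Implicit.
Unset Printing Implicit Defensive.
Import Order.TTheory GRing.Theory Num.Theory.
Local Open Scope ring_scope.

(* Rows and columns are indexed from 0. *)
Definition tridiag_toeplitz (R : pzRingType) (n : nat) (a b c : R) : 'M[R]_n :=
  \matrix_(i < n, j < n)
    (if i == j :> nat then b
     else if i == j.+1 :> nat then a
     else if j == i.+1 :> nat then c
     else 0).

Fixpoint chebyshevU (R : nzRingType) (m : nat) : {poly R} :=
  match m with
  | 0 => 1
  | m'.+1 =>
      match m' with
      | 0 => 2 *: 'X
      | k.+1 => 2 *: 'X * chebyshevU R m' - chebyshevU R k
      end
  end.

(* Main.v *)
Require Import Defs.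
From HB Require Import structures.
From mathcomp Require Import all_boot all_order all_algebra.
From mathcomp Require Import reals.
From mathcomp Require Import ring.
Set Implicit Arguments.
Unset Strict Implicit.
Unset Printing Implicit Defensive.
Import Order.TTheory GRing.Theory Num.Theory.
Local Open Scope ring_scope.

(** Expanding the determinant of a tridiagonal Toeplitz matrix along its first
    row gives the recurrence [D_(n+2) = b D_(n+1) - a c D_n], in which [a] and
    [c] occur only through their product.  If [s ^+ 2 = a * c] and
    [b = 2 * s * y], dividing [D_n] by [s ^+ n] turns this into the defining
    recurrence [2 y U_(n+1) - U_n] of the Chebyshev polynomials at [y]; the
    initial values agree as well ([det_tridiag_toeplitz_chebyshevU]).

    The characteristic polynomial needs no second computation:
    [t%:M - A_n(a, b, c)] is again tridiagonal Toeplitz, with parameters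
    [- a], [t - b], [- c], and the two signs cancel in the product [a * c]. *)

Lemma det_tridiag_toeplitz_rec (R : comNzRingType) (n : nat) (a b c : R) :
  \det (tridiag_toeplitz n.+2 a b c) =
    b * \det (tridiag_toeplitz n.+1 a b c)
    - a * c * \det (tridiag_toeplitz n a b c).
Proof.
rewrite (expand_det_row _ ord0) !big_ord_recl big1 => [|i _]; last first.
  by rewrite mxE /= mul0r.
rewrite !mxE /= addr0 /cofactor /= expr0 mul1r expr1 mulN1r mulrN.
congr (_ * _ - _).
  congr (\det _); apply/matrixP => i j.
  by rewrite !mxE !lift0 !eqSS.
rewrite [a * c]mulrC -mulrA; congr (_ * _).
(* Deleting row 0 and column 1 leaves [a] as the only nonzero entry of the
   first column. *)
rewrite (expand_det_col _ ord0) big_ord_recl big1 => [|i _]; last first.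
  by rewrite !mxE /= mul0r.
rewrite !mxE /= addr0 /cofactor /= expr0 mul1r.
congr (_ * \det _); apply/matrixP => i j.
by rewrite !mxE /= /bump /= !add1n !eqSS.
Qed.

Lemma horner_chebyshevU_rec (R : comNzRingType) (n : nat) (y : R) :
  (chebyshevU R n.+2).[y] =
    2 * y * (chebyshevU R n.+1).[y] - (chebyshevU R n).[y].
Proof. by rewrite [chebyshevU R n.+2]/= hornerD hornerN hornerM hornerZ hornerX. Qed.

(** Writing the diagonal entry as [2 * s * y] rather than dividing by [2 * s]
    keeps the identity valid over every commutative ring. *)
Lemma det_tridiag_toeplitz_chebyshevU (R : comNzRingType) (n : nat)
    (a c s y : R) :
  s ^+ 2 = a * c ->
  \det (tridiag_toeplitz n a (2 * s * y) c) = s ^+ n * (chebyshevU R n).[y].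
Proof.
move=> s2; elim/ltn_ind: n => -[|[|n]] IHn.
- by rewrite det_mx00 hornerC mulr1.
- by rewrite det_mx11 mxE /= hornerZ hornerX; ring.
- rewrite det_tridiag_toeplitz_rec !IHn // horner_chebyshevU_rec -s2.
  by rewrite !exprS; ring.
Qed.

Lemma horner_char_poly (R : comNzRingType) (n : nat) (A : 'M[R]_n) (t : R) :
  (char_poly A).[t] = \det (t%:M - A).
Proof.
rewrite -horner_evalE -det_map_mx; congr (\det _).
apply/matrixP => i j; rewrite !mxE /=.
by rewrite horner_evalE !hornerE hornerMn hornerX.
Qed.

Lemma scalar_mx_sub_tridiag_toeplitz (R : comNzRingType) (n : nat)
    (a b c t : R) :
  t%:M - tridiag_toeplitz n a b c = tridiag_toeplitz n (- a) (t - b) (- c).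
Proof.
apply/matrixP => i j; rewrite !mxE -val_eqE /=.
case: eqP => // _; rewrite mulr0n add0r.
by do 2 case: ifP => // _; rewrite oppr0.
Qed.

Theorem proposition3p3 (R : realType) (n : nat) (hn : (1 <= n)%N)
    (a b c : R) (hac : 0 < a * c) :
  let s := Num.sqrt (a * c) in
  let A := tridiag_toeplitz n a b c in
  let x := b / (2 * s) in
  \det A = s ^+ n * (chebyshevU R n).[x] /\
  (forall t : R,
     (char_poly A).[t] = s ^+ n * (chebyshevU R n).[(t - b) / (2 * s)]).
Proof.
move=> s A x.
have s2 : s ^+ 2 = a * c by rewrite sqr_sqrtr // ltW.
have twos_neq0 : 2 * s != 0 by rewrite mulf_neq0 ?pnatr_eq0 // gt_eqF ?sqrtr_gt0.
have diagE d : d = 2 * s * (d / (2 * s)) by rewrite mulrC divfK.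
split=> [|t].
  by rewrite /A [b in LHS]diagE det_tridiag_toeplitz_chebyshevU.
rewrite horner_char_poly scalar_mx_sub_tridiag_toeplitz [t - b in LHS]diagE.
by rewrite det_tridiag_toeplitz_chebyshevU // mulrNN.
Qed.
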